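(* Let $x_1,\dots,x_n\in\mathbb{R}^d$, let $\kappa:\mathbb{R}^d\times\mathbb{R}^d\to\mathbb{R}$ be a positive semi-definite kernel, and suppose the kernel matrix $K=[\kappa(x_i,x_j)]_{n\times n}$ is invertible. Let $1\le m\le n$, and let $\xi\in\{0,1\}^n$ be the random indicator vector of a set of $m$ data points sampled uniformly at random without replacement from $x_1,\dots,x_n$. Then for every cluster membership matrix $U\in\mathcal{P}$ with all clusters non-empty, $$\mathbb{E}_{\xi}[\mathcal{L}(U,\xi)]\;\le\;\mathcal{L}(U,\mathbf{1})+\operatorname{tr}\!\left(\widetilde U\Big[K^{-1}+\frac{m}{n}[\operatorname{diag}(K)]^{-1}\Big]^{-1}\widetilde U^{\top}\right),$$ where $\mathcal{L}(U,\mathbf{1})=\operatorname{tr}(K)-\operatorname{tr}(\widetilde U K\widetilde U^{\top})$.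
   Context: $\mathcal{P}=\{U\in\{0,1\}^{C\times n}: U^{\top}\mathbf{1}=\mathbf{1}\}$ is the set of cluster membership matrices ($C$ is the number of clusters; $\mathbf{1}$ denotes a vector of all ones). Write $U=(u_1,\dots,u_C)^{\top}$, so $u_k\in\{0,1\}^n$ is the indicator vector of cluster $k$, and $n_k=u_k^{\top}\mathbf{1}$ is the number of points in cluster $k$ (non-empty clusters means $n_k\ge 1$ for all $k$). The $\ell_2$-normalized membership matrix is $\widetilde U=[\operatorname{diag}(\sqrt{n_1},\dots,\sqrt{n_C})]^{-1}U$. $\operatorname{diag}(K)$ is the diagonal matrix with the same diagonal as $K$. For $\xi\in\{0,1\}^n$, where $\xi_i=1$ if and only if $x_i$ is sampled, the clustering error is $$\mathcal{L}(U,\xi)=\operatorname{tr}(K)+\sum_{k=1}^C\mathcal{L}_k(U,\xi),$$ $$\mathcal{L}_k(U,\xi)=\min_{\alpha\in\mathbb{R}^n}\Big(-2u_k^{\top}K(\alpha\circ\xi)+n_k(\alpha\circ\xi)^{\top}K(\alpha\circ\xi)\Big),$$ where $\circ$ is the entrywise product. (This is the minimal sum of squared distances, in the reproducing kernel Hilbert space of $\kappa$, from the points $\kappa(x_i,\cdot)$ to the centers of their clusters, when the centers are restricted to the span of $\{\kappa(x_i,\cdot):\xi_i=1\}$.) *)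

(* Defs.v *)
From mathcomp Require Import all_boot all_order all_algebra.
From mathcomp Require Import all_classical all_reals all_analysis.

Set Implicit Arguments.
Unset Strict Implicit.
Unset Printing Implicit Defensive.

Import Order.TTheory GRing.Theory Num.Theory.

Local Open Scope classical_set_scope.
Local Open Scope ring_scope.

Definition psd_kernel (R : realType) (X : Type) (kappa : X -> X -> R) : Prop :=
  (forall x y, kappa x y = kappa y x) /\
  forall (p : nat) (z : 'I_p -> X) (c : 'I_p -> R),
    0 <= \sum_(i < p) \sum_(j < p) c i * c j * kappa (z i) (z j).

Definition kernel_matrix (R : realType) (X : Type) (kappa : X -> X -> R)
    (n : nat) (x : 'I_n -> X) : 'M[R]_n :=
  \matrix_(i, j) kappa (x i) (x j).

Definition diag_part (R : realType) (n : nat) (K : 'M[R]_n) : 'M[R]_n :=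
  diag_mx (\row_i K i i).

Section Clustering.
Variables (R : realType) (C n : nat).
Implicit Types (K : 'M[R]_n) (U : 'M[R]_(C, n)) (xi : 'cV[R]_n).

Definition membership U : Prop :=
  (forall k i, U k i = 0 \/ U k i = 1) /\
  U^T *m const_mx 1 = const_mx 1 :> 'cV[R]_n.

Definition cluster U (k : 'I_C) : 'cV[R]_n := (row k U)^T.

Definition cluster_size U (k : 'I_C) : R :=
  ((cluster U k)^T *m (const_mx 1 : 'cV[R]_n)) 0 0.

Definition normalized_membership U : 'M[R]_(C, n) :=
  invmx (diag_mx (\row_k Num.sqrt (cluster_size U k))) *m U.

Definition cluster_objective K U xi (k : 'I_C) (alpha : 'cV[R]_n) : R :=
  let beta := map2_mx *%R alpha xi in
  - 2 * ((cluster U k)^T *m K *m beta) 0 0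
  + cluster_size U k * (beta^T *m K *m beta) 0 0.

(* When K is symmetric positive semi-definite and U is a membership matrix,
   the objective is a quadratic function of alpha that is bounded below, so
   this infimum is attained and is the minimum over alpha. *)
Definition cluster_loss K U xi (k : 'I_C) : R :=
  inf (range (cluster_objective K U xi k)).

Definition clustering_error K U xi : R :=
  \tr K + \sum_(k < C) cluster_loss K U xi k.

End Clustering.

Definition indicator (R : realType) (n : nat) (S : {set 'I_n}) : 'cV[R]_n :=
  \col_i (i \in S)%:R.

(* Sampling without replacement is described by the random set S of sampled
   indices, which is uniform over the m-element subsets of the index set. *)
Definition uniform_sample (R : realType) (disp : measure_display)
    (Omega : measurableType disp) (P : probability Omega R) (n m : nat)
    (S : Omega -> {set 'I_n}) : Prop :=
  forall A : {set 'I_n},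
    measurable (S @^-1` [set A]) /\
    P (S @^-1` [set A]) = (if #|A| == m then ('C(n, m)%:R)^-1 else 0)%:E.

(* Main.v *)
(* Fix a cluster with indicator u and size c, and put p = m/n, D = diag K,
   M = K + p^-1 D. By Woodbury the k-th term of the claimed bound is
   -c^-1 u^T K M^-1 K u. It is obtained by bounding the minimum over alpha by the
   value at one alpha that does not depend on the sample,
   alpha = (p c)^-1 M^-1 K u. In expectation the masked quadratic form of alpha is
   q alpha^T K alpha + (p - q) alpha^T D alpha, q being the probability that two
   given distinct points are both sampled, and since 0 <= q <= p^2 this is at most
   p^2 alpha^T M alpha. *)

Require Import Defs.
From mathcomp Require Import all_boot all_order all_algebra.
From mathcomp Require Import all_classical all_reals all_analysis.
From mathcomp Require Import ring lra zify.

Set Implicit Arguments.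
Unset Strict Implicit.
Unset Printing Implicit Defensive.

Import Order.TTheory GRing.Theory Num.Theory.

Local Open Scope classical_set_scope.
Local Open Scope ring_scope.

(** * Averages over the [m]-element subsets *)

Definition subset_mean (R : realType) (n m : nat) (f : {set 'I_n} -> R) : R :=
  (\sum_(A : {set 'I_n} | #|A| == m) f A) / 'C(n, m)%:R.

Lemma expectation_uniform_sample (R : realType) (disp : measure_display)
    (Omega : measurableType disp) (P : probability Omega R) (n m : nat)
    (S : Omega -> {set 'I_n}) (f : {set 'I_n} -> R) :
  uniform_sample P m S -> 'E_P[f \o S]%E = (subset_mean m f)%:E.
Proof.
move=> S_unif; rewrite unlock.
(* Only finitely many sets can be drawn, so the integrand splits into its values times the
   indicators of the events [S = A], and linearity applies. *)
pose g (A : {set 'I_n}) w := ((f A)%:E * (\1_(S @^-1` [set A]) w)%:E)%E.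
have gi A : P.-integrable setT (g A).
  by apply: integrableZl => //; apply: integrable_indic; have [] := S_unif A.
rewrite (eq_integral (fun w => \sum_(A : {set 'I_n}) g A w)%E); last first.
  move=> w _ /=; rewrite (bigD1 (S w)) //= big1 ?adde0 => [|A /eqP AS].
    by rewrite /g indicE mem_set // mule1.
  by rewrite /g indicE memNset ?mule0 // => SA; apply: AS.
rewrite integral_sum // /subset_mean mulr_suml -sumEFin.
rewrite big_mkcond [RHS]big_mkcond /=.
apply: eq_bigr => A _; have [mA PA] := S_unif A.
rewrite integralZl //; last exact: integrable_indic.
rewrite integral_indic // setIT [X in (_ * X)%E]PA.
by case: ifP; rewrite ?mule0 // EFinM.
Qed.

(** Complementation turns these sets into the subsets of [~: B] with [#|T| - m] elements. The count
    stays correct when [B] has more than [m] elements, as the binomial is then 0. *)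
Lemma card_supersets (T : finType) (B : {set T}) m : (m <= #|T|)%N ->
  #|[set A : {set T} | (B \subset A) & (#|A| == m)]|
    = 'C(#|T| - #|B|, #|T| - m).
Proof.
move=> mT; have -> : (#|T| - #|B|)%N = #|~: B|.
  by rewrite [RHS]cardsCs finset.setCK.
rewrite -cards_draws -[RHS](card_preimset _ (@finset.setC_inj T)).
apply: eq_card => A; rewrite !inE finset.setCS; congr (_ && _).
rewrite [in LHS]cardsCs; apply/eqP/eqP => [<-|->]; last by rewrite subKn.
by rewrite subKn // max_card.
Qed.

Section SubsetMean.
Variables (R : realType) (n m : nat).
Implicit Types f g : {set 'I_n} -> R.

Lemma subset_mean_le f g :
  (forall A, f A <= g A) -> subset_mean m f <= subset_mean m g.
Proof.
by move=> fg; rewrite ler_wpM2r ?invr_ge0 ?ler0n //; exact: ler_sum.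
Qed.

Lemma subset_mean_sum (I : finType) (F : I -> {set 'I_n} -> R) :
  subset_mean m (fun A => \sum_i F i A) = \sum_i subset_mean m (F i).
Proof. by rewrite /subset_mean exchange_big mulr_suml. Qed.

Lemma subset_meanD f g :
  subset_mean m (fun A => f A + g A) = subset_mean m f + subset_mean m g.
Proof. by rewrite /subset_mean big_split mulrDl. Qed.

Lemma subset_meanZ c f :
  subset_mean m (fun A => c * f A) = c * subset_mean m f.
Proof. by rewrite /subset_mean -mulr_sumr mulrA. Qed.

Hypothesis le_mn : (m <= n)%N.

Lemma subset_mean_cst (c : R) : subset_mean m (fun _ : {set 'I_n} => c) = c :> R.
Proof.
rewrite /subset_mean sumr_const -cardsE card_draws card_ord.
rewrite -[c *+ _]mulr_natr mulfK //.
by rewrite pnatr_eq0 -lt0n bin_gt0.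
Qed.

Lemma subset_mean_superset (B : {set 'I_n}) :
  subset_mean m (fun A => (B \subset A)%:R)
    = 'C(n - #|B|, n - m)%:R / 'C(n, m)%:R :> R.
Proof.
rewrite /subset_mean -natr_sum.
have := @card_supersets _ B m; rewrite card_ord => /(_ le_mn) <-.
by rewrite -sum1dep_card big_mkcondl; congr (_ / _).
Qed.

Lemma subset_mean_mem (i : 'I_n) :
  subset_mean m (fun A => (i \in A)%:R) = m%:R / n%:R :> R.
Proof.
have -> : (fun A : {set 'I_n} => (i \in A)%:R : R)
    = fun A => ([set i]%SET \subset A)%:R.
  by apply/funext => A; rewrite finset.sub1set.
have n0 : (0 < n)%N by rewrite (leq_ltn_trans _ (ltn_ord i)).
rewrite subset_mean_superset cards1 subn1.
have := mul_bin_down n (n - m); rewrite subKn // bin_sub // => e.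
apply/eqP; rewrite eqr_div ?pnatr_eq0 -?lt0n ?bin_gt0 //.
by rewrite -!natrM mulnC e.
Qed.

(* The probability that two distinct indices are both sampled; with the truncated
   [n - 2] it is [1] for [n = m = 1], so [pair_inclusion_le] still holds. *)
Definition pair_inclusion : R := 'C(n - 2, n - m)%:R / 'C(n, m)%:R.

(** For [i = j] the pair collapses to a singleton, so the value becomes [m / n]; the last term is
    this diagonal correction. *)
Lemma subset_mean_mem2 (i j : 'I_n) :
  subset_mean m (fun A => (i \in A)%:R * (j \in A)%:R)
    = pair_inclusion + (m%:R / n%:R - pair_inclusion) *+ (i == j).
Proof.
have -> : (fun A : {set 'I_n} => (i \in A)%:R * (j \in A)%:R : R)
    = fun A => ([set i; j]%SET \subset A)%:R.
  by apply/funext => A; rewrite finset.subUset !finset.sub1set -natrM mulnb.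
have [->|ij] := eqVneq i j; last first.
  by rewrite subset_mean_superset cards2 ij addr0.
rewrite mulr1n addrC subrK -(subset_mean_mem j); congr subset_mean.
by apply/funext => A; rewrite finset.setUid finset.sub1set.
Qed.

Lemma pair_inclusion_ge0 : 0 <= pair_inclusion.
Proof. by rewrite divr_ge0 ?ler0n. Qed.

(** For [n >= 2] the left side is m(m-1) / (n(n-1)), and (m-1)/(n-1) <= m/n because m <= n. *)
Lemma pair_inclusion_le : (0 < n)%N -> pair_inclusion <= (m%:R / n%:R) ^+ 2.
Proof.
move=> n0; rewrite /pair_inclusion expr_div_n.
rewrite ler_pdivrMr ?ltr0n ?bin_gt0 // mulrAC ler_pdivlMr ?exprn_gt0 ?ltr0n //.
rewrite -!natrX -!natrM ler_nat.
have := mul_bin_down n (n - m); have := mul_bin_down n.-1 (n - m).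
rewrite subKn // bin_sub // -[n.-1.-1]subn2.
set a := 'C(n, m); set b := 'C(_.-1, _); set c := 'C(n - 2, _) => e1 e2.
(* Here [n - 2] truncates to 0, so [c] is 0 for [m = 0] and 1 for [m = 1]. *)
have [n1|n1] := eqVneq n 1%N.
  have : (c <= 1)%N by rewrite /c n1; case: (1 - m)%N.
  have : (c = 0)%N \/ m = 1%N.
    by rewrite /c n1; move: le_mn; rewrite n1; case: m => [|[]]; auto.
  have : (0 < a)%N by rewrite bin_gt0.
  rewrite n1 => a0 [->|->] c1; rewrite ?mul0n // !exp1n muln1 mul1n.
  exact: leq_trans c1 a0.
(* The two absorption identities, chained; [n.-1 - (n - m)] is m - 1, truncated at 0. *)
have e3 : (n.-1 * (c * n ^ 2) = n * (n.-1 - (n - m)) * (m * a))%N.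
  rewrite mulnA e1 -e2 -mulnn; set t := (_ - _)%N; lia.
have : (n * (n.-1 - (n - m)) <= m * n.-1)%N by nia.
move=> le; rewrite -(leq_pmul2l (_ : 0 < n.-1)%N); last by lia.
by rewrite e3; have := leq_mul le (leqnn (m * a)); rewrite -mulnn; lia.
Qed.

End SubsetMean.

(** * Quadratic forms of a positive semi-definite matrix *)

Section QuadraticForms.
Variables (R : realType) (n : nat) (K : 'M[R]_n).
Implicit Types u v w : 'cV[R]_n.

Definition form u v : R := (u^T *m K *m v) 0 0.

Lemma formDr u v w : form u (v + w) = form u v + form u w.
Proof. by rewrite /form mulmxDr mxE. Qed.

Lemma formZr a u v : form u (a *: v) = a * form u v.
Proof. by rewrite /form -scalemxAr mxE. Qed.

Lemma formDl u v w : form (u + v) w = form u w + form v w.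
Proof. by rewrite /form linearD /= !mulmxDl mxE. Qed.

Lemma formZl a u v : form (a *: u) v = a * form u v.
Proof. by rewrite /form linearZ /= -!scalemxAl mxE. Qed.

Hypothesis K_sym : K^T = K.

Lemma formC u v : form u v = form v u.
Proof.
have -> : form u v = (u^T *m K *m v)^T 0 0 by rewrite [RHS]mxE.
by rewrite !trmx_mul trmxK K_sym mulmxA.
Qed.

Hypothesis K_psd : forall v, 0 <= form v v.

(** The degenerate case of Cauchy-Schwarz: an isotropic vector is orthogonal to every vector, hence
    to the basis vectors, which read off the entries of [K *m v]. *)
Lemma form_eq0 v : form v v = 0 -> K *m v = 0.
Proof.
move=> v0.
have orth w : form w v = 0.
  pose a := form w w; pose b := form w v.
  (* The form at [w - t *: v] is [a - 2 * t * b], affine in [t]. If [b != 0], this choice of [t]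
     makes it [- a - 2], which is negative. *)
  have : 0 <= form (w - (b^-1 * (a + 1)) *: v) (w - (b^-1 * (a + 1)) *: v).
    exact: K_psd.
  rewrite -scaleNr !(formDl, formDr, formZl, formZr) v0 (formC v w) -/a -/b.
  have [//|b0] := eqVneq b 0.
  rewrite !mulr0 addr0 mulNr mulrAC mulVf // mul1r => le0.
  by have := K_psd w; rewrite -/a; lra.
apply/matrixP => i j; rewrite ord1 [RHS]mxE -(orth (delta_mx i 0)) /form.
by rewrite trmx_delta -mulmxA -rowE [RHS]mxE.
Qed.

Hypothesis K_unit : K \in unitmx.

Lemma form_definite v : form v v = 0 -> v = 0.
Proof. by move/form_eq0 => Kv; rewrite -(mulKmx K_unit v) Kv mulmx0. Qed.

Lemma diag_gt0 i : 0 < K i i.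
Proof.
have e : form (delta_mx i 0) (delta_mx i 0) = K i i.
  by rewrite /form trmx_delta -rowE -colE !mxE.
rewrite lt_def -e K_psd andbT; apply/eqP => /form_definite /matrixP /(_ i 0).
by rewrite !mxE !eqxx; apply/eqP; rewrite oner_eq0.
Qed.

End QuadraticForms.

Lemma form_mxD (R : realType) n (A B : 'M[R]_n) u v :
  form (A + B) u v = form A u v + form B u v.
Proof. by rewrite /form mulmxDr mulmxDl mxE. Qed.

Lemma form_mxZ (R : realType) n a (A : 'M[R]_n) u v :
  form (a *: A) u v = a * form A u v.
Proof. by rewrite /form -scalemxAr -scalemxAl mxE. Qed.

Lemma formE (R : realType) n (A : 'M[R]_n) u v :
  form A u v = \sum_j \sum_i u i 0 * A i j * v j 0.
Proof.
rewrite /form mxE; apply: eq_bigr => j _; rewrite mxE mulr_suml.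
by apply: eq_bigr => i _; rewrite !mxE.
Qed.

Lemma form_diag_part (R : realType) n (A : 'M[R]_n) v :
  form (diag_part A) v v = \sum_i v i 0 * A i i * v i 0.
Proof.
rewrite formE; apply: eq_bigr => i _.
rewrite (bigD1 i) //= big1 => [|j /negPf ji].
  by rewrite addr0 !mxE eqxx mulr1n.
by rewrite !mxE ji mulr0n mulr0 mul0r.
Qed.

(** * Matrix inverses *)

Lemma invmx_diag (F : fieldType) n (d : 'rV[F]_n) : (forall i, d 0 i != 0) ->
  diag_mx d \in unitmx /\ invmx (diag_mx d) = diag_mx (\row_i (d 0 i)^-1).
Proof.
move=> d0; have dd : diag_mx (\row_i (d 0 i)^-1) *m diag_mx d = 1%:M.
  by rewrite mulmx_diag; apply/matrixP => i j; rewrite !mxE mulVf.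
have [_ du] := mulmx1_unit dd; split=> //.
by rewrite -[RHS](mulmxK du) dd mul1mx.
Qed.

(** With M = K + p^-1 D, the matrix to invert factors as L = K^-1 M (p D^-1). Hence L is invertible
    and K L = M (p D^-1), so that (K - K M^-1 K) L = (M - K) (p D^-1) = 1. *)
Lemma woodbury (F : fieldType) n (K D : 'M[F]_n) (p : F) :
    p != 0 -> K \in unitmx -> D \in unitmx -> K + p^-1 *: D \in unitmx ->
  invmx (invmx K + p *: invmx D) = K - K *m invmx (K + p^-1 *: D) *m K.
Proof.
move=> p0 Ku Du; set M := K + _ => Mu.
set L := invmx K + _.
have e : L = invmx K *m M *m (p *: invmx D).
  rewrite /M mulmxDr mulVmx // mulmxDl mul1mx -!scalemxAr -scalemxAl.
  by rewrite scalerA mulfV // scale1r mulmxK // addrC.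
have Lu : L \in unitmx.
  by rewrite e !unitmx_mul unitmx_inv Ku Mu unitmxZ ?unitfE // unitmx_inv.
rewrite -[RHS](mulmxK Lu); apply: (canRL (mulmxK Lu)).
rewrite mulVmx // mulmxBl.
have KL : K *m L = M *m (p *: invmx D) by rewrite e !mulmxA mulmxV // mul1mx.
rewrite -[X in _ - X]mulmxA KL mulmxA mulmxKV // -mulmxBl addrAC subrr add0r.
by rewrite -scalemxAl -scalemxAr scalerA mulVf // scale1r mulmxV.
Qed.

(** * Means of the masked linear and quadratic terms *)

Section SampledObjective.
Variables (R : realType) (n m : nat).
Hypothesis le_mn : (m <= n)%N.
Local Notation p := (m%:R / n%:R : R).
Local Notation q := (pair_inclusion R n m).
Implicit Types (a : 'cV[R]_n) (M : 'M[R]_n).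

Lemma subset_mean_form_masked M (u : 'cV[R]_n) a :
  subset_mean m (fun A => form M u (map2_mx *%R a (indicator R A)))
    = p * form M u a.
Proof.
have -> : (fun A => form M u (map2_mx *%R a (indicator R A)))
    = fun A => \sum_j (u^T *m M) 0 j * a j 0 * (j \in A)%:R.
  by apply/funext => A; rewrite /form mxE; apply: eq_bigr => j _;
    rewrite !mxE mulrA.
rewrite subset_mean_sum /form [in RHS]mxE mulr_sumr; apply: eq_bigr => j _.
by rewrite subset_meanZ subset_mean_mem // mulrC.
Qed.

(** Masking multiplies the [(i, j)] term by the product of two membership indicators, whose mean is
    [q] off the diagonal and [p] on it. *)
Lemma subset_mean_form_masked2 M a :
  subset_mean m (fun A => form M (map2_mx *%R a (indicator R A))
                                 (map2_mx *%R a (indicator R A)))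
    = q * form M a a + (p - q) * form (diag_part M) a a.
Proof.
have -> : (fun A => form M (map2_mx *%R a (indicator R A))
                           (map2_mx *%R a (indicator R A)))
    = fun A => \sum_j \sum_i (a i 0 * M i j * a j 0)
                             * ((i \in A)%:R * (j \in A)%:R).
  apply/funext => A; rewrite formE; apply: eq_bigr => j _; apply: eq_bigr => i _.
  by rewrite !mxE; ring.
rewrite subset_mean_sum formE form_diag_part !mulr_sumr -big_split /=.
apply: eq_bigr => j _; rewrite subset_mean_sum /=.
under eq_bigr => i _ do rewrite subset_meanZ subset_mean_mem2 // mulrDr.
rewrite big_split /= mulr_sumr; congr (_ + _).
  by apply: eq_bigr => i _; rewrite mulrC.
rewrite (bigD1 j) //= big1 => [|i /negPf ij]; last by rewrite ij mulr0n mulr0.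
by rewrite eqxx mulr1n addr0 mulrC.
Qed.

End SampledObjective.

(** * The loss of a single cluster *)

Section ClusterLoss.
Variables (R : realType) (C n : nat).
Variables (K : 'M[R]_n) (U : 'M[R]_(C, n)) (k : 'I_C).
Hypothesis K_sym : K^T = K.
Hypothesis K_psd : forall v, 0 <= form K v v.
Hypothesis size_gt0 : 0 < cluster_size U k.
Local Notation u := (Defs.cluster U k).
Local Notation c := (cluster_size U k).

(** Completing the square: the difference of the two sides is [c] times the form at [b - c^-1 *: u].
    The bound also makes the infimum in [cluster_loss] that of a set bounded below. *)
Lemma cluster_objective_ge xi a :
  - (c^-1 * form K u u) <= cluster_objective K U xi k a.
Proof.
rewrite /cluster_objective; set b := map2_mx _ _ _.
rewrite -/(form K u b) -/(form K b b).
have := mulr_ge0 (ltW size_gt0) (K_psd (b + (- c^-1) *: u)).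
rewrite !(formDl, formDr, formZl, formZr) (formC K_sym b u).
suff -> : c * (form K b b + - c^-1 * form K u b
    + (- c^-1 * form K u b + - c^-1 * (- c^-1 * form K u u)))
  = - 2 * form K u b + c * form K b b + c^-1 * form K u u 
    by rewrite -lerBlDr sub0r.
by field; rewrite gt_eqF.
Qed.

Lemma cluster_loss_le xi a :
  cluster_loss K U xi k <= cluster_objective K U xi k a.
Proof.
apply: ge_inf; last by exists a.
by exists (- (c^-1 * form K u u)) => _ [b _ <-]; exact: cluster_objective_ge.
Qed.

(** Without masking, the completed square vanishes at [c^-1 *: u], the cluster mean, so the lower
    bound is attained. *)
Lemma cluster_loss_full :
  cluster_loss K U (const_mx 1) k = - (c^-1 * form K u u).
Proof.
apply/eqP; rewrite eq_le; apply/andP; split; last first.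
  apply: lb_le_inf; first by exists (cluster_objective K U (const_mx 1) k 0), 0.
  by move=> _ [b _ <-]; exact: cluster_objective_ge.
apply: (le_trans (cluster_loss_le _ (c^-1 *: u))).
rewrite /cluster_objective.
have -> : map2_mx *%R (c^-1 *: u) (const_mx 1) = c^-1 *: u.
  by apply/matrixP => i j; rewrite !mxE mulr1.
rewrite -/(form K u _) -/(form K (c^-1 *: u) _) !(formZl, formZr).
by rewrite le_eqVlt; apply/orP; left; apply/eqP; field; rewrite gt_eqF.
Qed.

Lemma subset_mean_cluster_loss_le m : K \in unitmx -> (0 < m <= n)%N ->
  subset_mean m (fun A => cluster_loss K U (indicator R A) k)
  <= c^-1 * (form (invmx (invmx K + (m%:R / n%:R) *: invmx (diag_part K))) u u
             - form K u u).
Proof.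
move=> K_unit /andP[m0 le_mn]; have n0 : (0 < n)%N := leq_trans m0 le_mn.
set p : R := m%:R / n%:R; set D := diag_part K.
have p0 : 0 < p by rewrite divr_gt0 ?ltr0n.
have K0 := diag_gt0 K_sym K_psd K_unit.
have /invmx_diag[D_unit _] i : (\row_j K j j) 0 i != 0 by rewrite mxE gt_eqF.
have D_psd v : 0 <= form D v v.
  rewrite form_diag_part sumr_ge0 // => i _.
  by rewrite mulrAC mulr_ge0 ?(ltW (K0 i)) // -expr2 sqr_ge0.
pose M := K + p^-1 *: D.
have M_unit : M \in unitmx.
  (* A null vector of [M] is isotropic for [M]; both summands of [M] give nonnegative values, so it
     is isotropic for [K] and hence zero. *)
  rewrite -unitmx_tr -row_free_unit -kermx_eq0; apply/rowV0P => v /sub_kermxP vM.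
  apply: trmx_inj; rewrite trmx0; apply: (form_definite K_sym K_psd K_unit).
  have : form M v^T v^T = 0.
    by rewrite /form -mulmxA -[M]trmxK -trmx_mul vM trmx0 mulmx0 mxE.
  rewrite form_mxD form_mxZ => /eqP.
  rewrite paddr_eq0 ?K_psd ?mulr_ge0 ?invr_ge0 ?(ltW p0) ?D_psd //.
  by case/andP => /eqP.
rewrite woodbury ?gt_eqF // -/M.
have -> : form (K - K *m invmx M *m K) u u
    = form K u u - form K u (invmx M *m K *m u).
  by rewrite /form mulmxBr mulmxBl !mulmxA [LHS]mxE [X in _ + X = _]mxE.
(* This [a] minimizes -2 p u^T K a + c p^2 a^T M a, the mean objective with its quadratic part
   replaced by the upper bound. *)
set b := invmx M *m K *m u; pose a := (p * c)^-1 *: b.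
(* Since [K *m u = M *m b], everything is expressed through the forms of [K] and [D] at [b]. *)
have Kub : form K u b = form K b b + p^-1 * form D b b.
  rewrite -form_mxZ -form_mxD -/M (formC K_sym) /form -!mulmxA.
  by congr ((_ *m _) 0 0); rewrite /b -!mulmxA mulKVmx.
have : subset_mean m (fun A => cluster_loss K U (indicator R A) k)
    <= subset_mean m (fun A => cluster_objective K U (indicator R A) k a).
  by apply: subset_mean_le => A; exact: cluster_loss_le.
move/le_trans; apply.
rewrite /cluster_objective.
rewrite subset_meanD !subset_meanZ subset_mean_form_masked //
  subset_mean_form_masked2 // -/p -/D.
set q := pair_inclusion R n m.
have q_le : q <= p ^+ 2 by exact: pair_inclusion_le.
have q_ge0 : 0 <= q by exact: pair_inclusion_ge0.
rewrite /a !(formZl, formZr) Kub.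
set x := form K b b; set y := form D b b.
have x0 : 0 <= x by exact: K_psd.
have y0 : 0 <= y by exact: D_psd.
rewrite -subr_ge0.
(* The terms in p y cancel in the gap between bound and value; what remains is nonnegative because 0
   <= q <= p^2. *)
rewrite [X in 0 <= X](_ : _ = c^-1 * p^-1 ^+ 2 * ((p ^+ 2 - q) * x + q * y)).
  by rewrite mulr_ge0 ?mulr_ge0 ?addr_ge0 ?mulr_ge0 ?exprn_ge0 ?invr_ge0
    ?subr_ge0 ?(ltW p0) ?(ltW size_gt0).
by field; rewrite !gt_eqF.
Qed.

End ClusterLoss.

(** * From clusters to traces, and the final bound *)

Lemma trace_normalized_membership (R : realType) (C n : nat)
    (U : 'M[R]_(C, n)) (A : 'M[R]_n) : (forall k, 0 < cluster_size U k) ->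
  \tr (normalized_membership U *m A *m (normalized_membership U)^T)
    = \sum_k (cluster_size U k)^-1 * form A (Defs.cluster U k) (Defs.cluster U k).
Proof.
move=> U0; apply: eq_bigr => k _.
have /invmx_diag[_ e] i : (\row_j Num.sqrt (cluster_size U j)) 0 i != 0.
  by rewrite mxE gt_eqF // sqrtr_gt0.
(* The factor is the inverse root of the cluster size; it occurs twice in a diagonal entry, which
   yields the weight [(cluster_size U k)^-1]. *)
have r : row k (normalized_membership U)
    = (Num.sqrt (cluster_size U k))^-1 *: row k U.
  rewrite /normalized_membership e row_mul row_diag_mx -scalemxAl -rowE.
  by congr (_ *: _); rewrite !mxE.
have -> : (normalized_membership U *m A *m (normalized_membership U)^T) k k
    = form A (row k (normalized_membership U))^T
             (row k (normalized_membership U))^T.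
  rewrite /form trmxK tr_row -row_mul [LHS]mxE [RHS]mxE.
  by apply: eq_bigr => j _; rewrite [row _ _ _ _]mxE [col _ _ _ _]mxE.
rewrite r linearZ /= formZl formZr mulrA -invfM -expr2 sqr_sqrtr //.
exact: ltW.
Qed.

Lemma kernel_matrix_sym (R : realType) (X : Type) (kappa : X -> X -> R) n
    (x : 'I_n -> X) : psd_kernel kappa ->
  (kernel_matrix kappa x)^T = kernel_matrix kappa x.
Proof. by case=> sym _; apply/matrixP => i j; rewrite !mxE. Qed.

Lemma kernel_matrix_psd (R : realType) (X : Type) (kappa : X -> X -> R) n
    (x : 'I_n -> X) v : psd_kernel kappa -> 0 <= form (kernel_matrix kappa x) v v.
Proof.
case=> _ /(_ n x (fun i => v i 0)); rewrite formE exchange_big /=.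
congr (0 <= _); apply: eq_bigr => j _; apply: eq_bigr => i _.
by rewrite mxE mulrAC.
Qed.

Theorem theorem1 (R : realType) (d n m : nat) (x : 'I_n -> 'cV[R]_d)
    (kappa : 'cV[R]_d -> 'cV[R]_d -> R)
    (disp : measure_display) (Omega : measurableType disp)
    (P : probability Omega R) (S : Omega -> {set 'I_n})
    (kappa_psd : psd_kernel kappa)
    (K_unit : kernel_matrix kappa x \in unitmx)
    (m_bounds : (1 <= m <= n)%N)
    (S_unif : uniform_sample P m S)
    (C : nat) (U : 'M[R]_(C, n)) (U_mem : membership U)
    (U_nonempty : forall k, 1 <= cluster_size U k) :
  let K := kernel_matrix kappa x in
  let Ut := normalized_membership U in
  ('E_P[fun w => clustering_error K U (indicator R (S w))]
    <= (clustering_error K U (const_mx 1)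
        + \tr (Ut *m invmx (invmx K + (m%:R / n%:R) *: invmx (diag_part K))
               *m Ut^T))%:E)%E
  /\ clustering_error K U (const_mx 1) = \tr K - \tr (Ut *m K *m Ut^T).
Proof.
move=> K Ut; have [m0 le_mn] := andP m_bounds.
have K_sym : K^T = K by exact: kernel_matrix_sym.
have K_psd v : 0 <= form K v v by exact: kernel_matrix_psd.
have U0 k : 0 < cluster_size U k by exact: lt_le_trans ltr01 _.
have full : clustering_error K U (const_mx 1) = \tr K - \tr (Ut *m K *m Ut^T).
  rewrite /clustering_error trace_normalized_membership // -sumrN.
  by congr (_ + _); apply: eq_bigr => k _; rewrite cluster_loss_full.
split=> //.
rewrite (expectation_uniform_sample
  (fun A => clustering_error K U (indicator R A)) S_unif).
rewrite lee_fin full /clustering_error subset_meanD subset_mean_cst //.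
rewrite subset_mean_sum.
(* Once [\tr K] is cancelled, both traces become sums over clusters and the inequality is checked
   cluster by cluster. *)
rewrite -addrA lerD2l !trace_normalized_membership // addrC -sumrB.
apply: ler_sum => k _; rewrite -mulrBr.
exact: subset_mean_cluster_loss_le.
Qed.
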